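(* Let $K$ be a field of characteristic different from $2$ and let $F_{p,q}(\mathfrak B_{\rm sup})$ be the free bicommutative superalgebra over $K$ freely generated by $p$ even generators $y_1,\dots,y_p$ and $q$ odd generators $z_1,\dots,z_q$. Its Hilbert series are $$H(F_{p,q}(\mathfrak B_{\rm sup}),U_p,V_q)=\sum_{i=1}^pu_i+\sum_{j=1}^qv_j+\left(\prod_{i=1}^p\frac{1}{1-u_i}\prod_{j=1}^q(1+v_j)-1\right)^2,$$ $$H(F_{p,q}(\mathfrak B_{\rm sup}),u,v)=pu+qv+\left(\frac{(1+v)^q}{(1-u)^p}-1\right)^2,$$ $$H(F_{p,q}(\mathfrak B_{\rm sup}),t)=(p+q)t+\left(\frac{(1+t)^q}{(1-t)^p}-1\right)^2.$$
   Context: Algebras are not assumed associative or unital. A superalgebra is an algebra $A=A_0\oplus A_1$ with $A_iA_j\subseteq A_{i+j\,(\mathrm{mod}\,2)}$; for $a\in A_i$ write $\overline a=i$. A superalgebra is bicommutative if for all homogeneous elements $x_1(x_2x_3)=(-1)^{\overline{x_1}\,\overline{x_2}}x_2(x_1x_3)$ and $(x_1x_2)x_3=(-1)^{\overline{x_2}\,\overline{x_3}}(x_1x_3)x_2$. The free bicommutative superalgebra on given even and odd generators is defined by the usual universal property: every parity-preserving map from the generators to a bicommutative superalgebra extends uniquely to a superalgebra homomorphism. Gradings and Hilbert series of $F=F_{p,q}(\mathfrak B_{\rm sup})$: $F^{(n)}$ is the homogeneous component of total degree $n$ in the generators; $F^{(k,l)}$ is the component of degree $k$ in the even generators and degree $l$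 in the odd generators; $F^{(\mathbf k,\mathbf l)}$, $\mathbf k=(k_1,\dots,k_p)$, $\mathbf l=(l_1,\dots,l_q)$, is the component of degree $k_i$ in $y_i$ and $l_j$ in $z_j$ for all $i,j$. The Hilbert series are the formal power series $H(F,t)=\sum_{n\ge1}\dim(F^{(n)})t^n$, $H(F,u,v)=\sum_{k+l\ge1}\dim(F^{(k,l)})u^kv^l$, $H(F,U_p,V_q)=\sum_{k_i,l_j}\dim(F^{(\mathbf k,\mathbf l)})u_1^{k_1}\cdots u_p^{k_p}v_1^{l_1}\cdots v_q^{l_q}$. *)

(* Defs.v *)
From HB Require Import structures.
From mathcomp Require Import all_boot all_order all_algebra.
From mathcomp Require Import boolp.
From mathcomp.multinomials Require Import mpoly.

Set Implicit Arguments.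
Unset Strict Implicit.
Unset Printing Implicit Defensive.

Import GRing.Theory.
Local Open Scope ring_scope.

(* Formal power series in [n] commuting variables with integer coefficients,
   indexed by exponent vectors ['X_{1..n}]. *)
Record fps (n : nat) := FPS { fcoef : 'X_{1..n} -> int }.

HB.instance Definition _ (n : nat) := gen_eqMixin (fps n).
HB.instance Definition _ (n : nat) := gen_choiceMixin (fps n).

Section FpsRing.
Context {n : nat}.
Implicit Types (f g h : fps n) (m : 'X_{1..n}).

Lemma fpsP f g : fcoef f =1 fcoef g -> f = g.
Proof. by case: f g => [f] [g] /= /funext ->. Qed.

Definition fps_zero : fps n := FPS (fun=> 0).
Definition fps_one : fps n := FPS (fun m => (m == 0%MM)%:R).
Definition fps_opp f : fps n := FPS (fun m => - fcoef f m).
Definition fps_add f g : fps n := FPS (fun m => fcoef f m + fcoef g m).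
(* The bound on the degrees only serves to make the index set finite. *)
Definition fps_mul f g : fps n := FPS (fun m =>
  \sum_(k : 'X_{1..n < (mdeg m).+1, (mdeg m).+1} | m == (k.1 + k.2)%MM)
     fcoef f k.1 * fcoef g k.2).

Fact fps_addA : associative fps_add.
Proof. by move=> f g h; apply: fpsP => m /=; rewrite addrA. Qed.
Fact fps_addC : commutative fps_add.
Proof. by move=> f g; apply: fpsP => m /=; rewrite addrC. Qed.
Fact fps_add0 : left_id fps_zero fps_add.
Proof. by move=> f; apply: fpsP => m /=; rewrite add0r. Qed.
Fact fps_addN : left_inverse fps_zero fps_opp fps_add.
Proof. by move=> f; apply: fpsP => m /=; rewrite addNr. Qed.

HB.instance Definition _ :=
  GRing.isZmodule.Build (fps n) fps_addA fps_addC fps_add0 fps_addN.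

(* [agree d P f]: the polynomial [P] coincides with [f] in degrees < d. *)
Let agree d (P : {mpoly int[n]}) f :=
  forall m, (mdeg m < d)%N -> P@_m = fcoef f m.

Let trunc d f : {mpoly int[n]} :=
  \sum_(k : 'X_{1..n < d}) fcoef f k *: 'X_[k].

Let agree_trunc d f : agree d (trunc d f) f.
Proof. by move=> m; apply: mcoeff_mpoly. Qed.

Let agreeM d P Q f g : agree d P f -> agree d Q g ->
  agree d (P * Q) (fps_mul f g).
Proof.
move=> Pf Qg m md; rewrite (mcoeff_poly_mul _ _ (ltnSn (mdeg m))) /=.
by apply: eq_bigr => k _; rewrite Pf ?Qg // (leq_trans (bmdeg _)).
Qed.

Let agree1 d : agree d 1 fps_one.
Proof. by move=> m _; rewrite mcoeff1. Qed.

Let agreeD d P Q f g : agree d P f -> agree d Q g ->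
  agree d (P + Q) (fps_add f g).
Proof. by move=> Pf Qg m md; rewrite mcoeffD Pf ?Qg. Qed.

Let agree_eq f g : (forall d, exists2 P, agree d P f & agree d P g) -> f = g.
Proof.
move=> fg; apply: fpsP => m; have [P Pf Pg] := fg (mdeg m).+1.
by rewrite -Pf ?Pg.
Qed.

Fact fps_mulA : associative fps_mul.
Proof.
move=> f g h; apply: agree_eq => d.
exists (trunc d f * (trunc d g * trunc d h)); last rewrite mulrA;
  by do !apply: agreeM; apply: agree_trunc.
Qed.
Fact fps_mulC : commutative fps_mul.
Proof.
move=> f g; apply: agree_eq => d.
exists (trunc d f * trunc d g); last rewrite mulrC;
  by apply: agreeM; apply: agree_trunc.
Qed.
Fact fps_mul1 : left_id fps_one fps_mul.
Proof.
move=> f; apply: agree_eq => d; exists (1 * trunc d f).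
  by apply: agreeM; [apply: agree1 | apply: agree_trunc].
by rewrite mul1r; apply: agree_trunc.
Qed.
Fact fps_mulDl : left_distributive fps_mul fps_add.
Proof.
move=> f g h; apply: agree_eq => d.
exists ((trunc d f + trunc d g) * trunc d h).
  by apply: agreeM; [apply: agreeD|]; apply: agree_trunc.
by rewrite mulrDl; apply: agreeD; apply: agreeM; apply: agree_trunc.
Qed.
Fact fps_one_neq0 : fps_one != fps_zero.
Proof. by apply/eqP => /(congr1 (fun f => fcoef f 0%MM)); rewrite /= eqxx. Qed.

HB.instance Definition _ := GRing.Zmodule_isComNzRing.Build (fps n)
  fps_mulA fps_mulC fps_mul1 fps_mulDl fps_one_neq0.

Definition fps_unit : {pred fps n} := fun f => `[< exists g, g * f = 1 >].
Definition fps_inv f : fps n :=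
  if pselect (exists g, g * f = 1) is left ex then projT1 (cid ex) else f.

Fact fps_mulVf : {in fps_unit, left_inverse 1 fps_inv *%R}.
Proof.
move=> f /asboolP ex; rewrite /fps_inv; case: pselect => // ex'.
by case: cid.
Qed.
Fact fps_unitPl f g : g * f = 1 -> fps_unit f.
Proof. by move=> gf; apply/asboolP; exists g. Qed.
Fact fps_inv_out : {in [predC fps_unit], fps_inv =1 id}.
Proof.
move=> f /negP nf; rewrite /fps_inv; case: pselect => // ex.
by case: nf; apply/asboolP.
Qed.

HB.instance Definition _ := GRing.ComNzRing_hasMulInverse.Build (fps n)
  fps_mulVf fps_unitPl fps_inv_out.

Definition fpsX (i : 'I_n) : fps n := FPS (fun m => (m == U_(i)%MM)%:R).

Lemma fps_coefXM i f m :
  fcoef (fpsX i * f) m =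
  if (0 < m i)%N then fcoef f (m - U_(i))%MM else 0.
Proof.
have [mi0|mi] := posnP (m i).
  rewrite [LHS]big1 //= => k /eqP mk; case: eqP => [k1|]; last by rewrite mul0r.
  by have := congr1 (fun l : 'X_{1..n} => l i) mk; rewrite mi0 mnmDE k1 mnm1E eqxx.
have aX : agree (mdeg m).+1 'X_i (fpsX i).
  by move=> k _; rewrite mcoeffX eq_sym.
rewrite -(agreeM aX (@agree_trunc _ f)) // mulrC.
have le1 : (U_(i) <= m)%MM.
  by apply/mnm_lepP => j; rewrite mnm1E; case: eqP => [<-|].
have em : m = (U_(i) + (m - U_(i)))%MM by rewrite addmC submK.
by rewrite [X in _@_X]em mcoeffMX agree_trunc // ltnS mdegB.
Qed.

(* Hence [(1 - fpsX i)^-1] is a genuine inverse, the geometric series. *)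
Lemma fps_geom_unit i : 1 - fpsX i \is a GRing.unit.
Proof.
pose G : fps n := FPS (fun m => (m == (U_(i) *+ m i)%MM)%:R).
apply: (@fps_unitPl _ G); rewrite mulrC mulrBl mul1r.
apply: fpsP => m.
transitivity (fcoef G m - fcoef (fpsX i * G) m); first by [].
rewrite fps_coefXM /=; case: posnP => [mi0|mi].
  by rewrite mi0 mulm0n subr0.
rewrite mnmBE mnm1E eqxx subn1.
have -> : (m == 0%MM) = false.
  by apply/eqP => m0; rewrite m0 mnm0E in mi.
suff -> : ((m - U_(i))%MM == (U_(i) *+ (m i).-1)%MM) = (m == (U_(i) *+ m i)%MM).
  by rewrite subrr.
apply/eqP/eqP => /mnmP e; apply/mnmP => j; move: (e j);
  rewrite !(mulmnE, mnmBE, mnm1E); case: (eqVneq i j) => [<-|_];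
  by rewrite ?mul1n ?mul0n ?subn0 ?subn1.
Qed.
End FpsRing.

(* Superalgebras: algebras, neither associative nor unital in general, with a
   Z/2-grading; [spart A false] is [A_0] and [spart A true] is [A_1]. *)
Record superalgebra (K : fieldType) := Superalgebra {
  ssort :> lmodType K;
  smul : ssort -> ssort -> ssort;
  spart : bool -> {pred ssort};
  smul_linearr : forall x, linear (smul x);
  smul_linearl : forall y, linear (smul^~ y);
  spart_submod : forall i, submod_closed (spart i);
  spart_sum : forall x, exists x0 x1,
    [/\ x0 \in spart false, x1 \in spart true & x = x0 + x1];
  spart_cap : forall x, x \in spart false -> x \in spart true -> x = 0;
  spart_mul : forall i j x y,
    x \in spart i -> y \in spart j -> smul x y \in spart (i (+) j) }.

Arguments smul {K s}.
Arguments spart {K} s.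

Definition bicommutative (K : fieldType) (A : superalgebra K) : Prop :=
  forall (i j k : bool) (x1 x2 x3 : A),
    x1 \in spart A i -> x2 \in spart A j -> x3 \in spart A k ->
    smul x1 (smul x2 x3) = (-1) ^+ (i && j) *: smul x2 (smul x1 x3) /\
    smul (smul x1 x2) x3 = (-1) ^+ (j && k) *: smul (smul x1 x3) x2.

Definition superalgebra_hom (K : fieldType) (A B : superalgebra K)
    (phi : {linear A -> B}) : Prop :=
  (forall x y, phi (smul x y) = smul (phi x) (phi y)) /\
  (forall i x, x \in spart A i -> phi x \in spart B i).

(* Generators are indexed by ['I_p + 'I_q]: [inl i] is the even generator y_i
   and [inr j] the odd generator z_j. *)
Definition gen_parity (p q : nat) (x : 'I_p + 'I_q) : bool :=
  if x is inr _ then true else false.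

Definition parity_preserving (K : fieldType) (p q : nat) (A : superalgebra K)
    (g : 'I_p + 'I_q -> A) : Prop :=
  forall x, g x \in spart A (gen_parity x).

Definition free_bicommutative (K : fieldType) (p q : nat) (F : superalgebra K)
    (g : 'I_p + 'I_q -> F) : Prop :=
  [/\ bicommutative F, parity_preserving g &
    forall (B : superalgebra K) (f : 'I_p + 'I_q -> B),
      bicommutative B -> parity_preserving f ->
      exists phi : {linear F -> B},
        [/\ superalgebra_hom phi, forall x, phi (g x) = f x &
          forall psi : {linear F -> B},
            superalgebra_hom psi -> (forall x, psi (g x) = f x) ->
            psi =1 phi]].

(* Nonassociative monomials: bracketed nonempty words in the generators. *)
Inductive monomial (X : Type) : Type :=
| MGen of X
| MMul of monomial X & monomial X.

Fixpoint meval (K : fieldType) (A : superalgebra K) (X : Type) (g : X -> A)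
    (w : monomial X) : A :=
  match w with
  | MGen x => g x
  | MMul a b => smul (meval g a) (meval g b)
  end.

Fixpoint mweight (X : Type) (n : nat) (wt : X -> 'X_{1..n}) (w : monomial X) :
    'X_{1..n} :=
  match w with
  | MGen x => wt x
  | MMul a b => (mweight wt a + mweight wt b)%MM
  end.

Definition span (K : fieldType) (V : lmodType K) (S : V -> Prop) (v : V) : Prop :=
  exists (r : nat) (c : 'I_r -> K) (s : 'I_r -> V),
    (forall i, S (s i)) /\ v = \sum_i c i *: s i.

(* [V] may be infinite-dimensional; [has_dim U d] says that [U] has a basis
   with [d] elements. *)
Definition has_dim (K : fieldType) (V : lmodType K) (U : V -> Prop) (d : nat) :
    Prop :=
  exists b : 'I_d -> V,
    (forall c : 'I_d -> K, \sum_i c i *: b i = 0 -> forall i, c i = 0) /\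
    (forall v, U v <-> exists c : 'I_d -> K, v = \sum_i c i *: b i).

(* Homogeneous component of [A] of degree [m], for the grading in which the
   generator [g x] has degree [wt x]. *)
Definition hcomp (K : fieldType) (A : superalgebra K) (X : Type) (g : X -> A)
    (n : nat) (wt : X -> 'X_{1..n}) (m : 'X_{1..n}) : A -> Prop :=
  span (fun v => exists2 w : monomial X, mweight wt w = m & v = meval g w).

(* [H] is the Hilbert series: every component is finite-dimensional and its
   dimension is the coefficient of [H]. The degrees [wt x] used below are
   nonzero, so the component of degree 0 is the span of the empty set and the
   constant term of [H] is 0. *)
Definition is_hilbert_series (K : fieldType) (A : superalgebra K) (X : Type)
    (g : X -> A) (n : nat) (wt : X -> 'X_{1..n}) (H : fps n) : Prop :=
  forall m, exists2 d : nat, has_dim (hcomp g wt m) d & fcoef H m = d%:Z.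

Definition multidegree (p q : nat) (x : 'I_p + 'I_q) : 'X_{1..p + q} :=
  match x with
  | inl i => U_(lshift q i)%MM
  | inr j => U_(rshift p j)%MM
  end.

Definition bidegree (p q : nat) (x : 'I_p + 'I_q) : 'X_{1..2} :=
  match x with
  | inl _ => U_(ord0)%MM
  | inr _ => U_(ord_max)%MM
  end.

Definition total_degree (p q : nat) (x : 'I_p + 'I_q) : 'X_{1..1} := U_(ord0)%MM.

(* Main.v *)
From HB Require Import structures.
From Stdlib Require Import Setoid Morphisms.
Require Import Defs.
From mathcomp Require Import all_boot all_order all_algebra.
From mathcomp Require Import boolp.
From mathcomp.multinomials Require Import mpoly.

Set Implicit Arguments.
Unset Strict Implicit.
Unset Printing Implicit Defensive.

Import GRing.Theory.
Local Open Scope ring_scope.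

(** In a bicommutative superalgebra the left multiplications commute up to
    sign, so do the right multiplications, and on the square of the algebra
    left and right multiplications commute with each other.  Hence every
    nonassociative monomial that is not a generator equals, up to sign, a word
    [x_1 (... (x_k (((x y) y_1) ... y_l)))]
    which up to sign depends only on the multiset of its left letters
    [x, x_1, ..., x_k] and on the multiset of its right letters
    [y, y_1, ..., y_l] (lemmas [product_word] and [word_perm]).  As 2 is
    invertible, the word vanishes when an odd generator occurs twice among the
    left letters or twice among the right letters (lemma [word_repeated]).  So
    the square of [F] is spanned by pairs of nonempty supercommutative
    monomials.

    These pairs are linearly independent because of the following model.  For
    an associative supercommutative algebra [T], the product
    [(a, b) (c, d) = (a d, a d)] makes [T * T] a bicommutative superalgebra
    (lemma [doubled_bicommutative]).  Take for [T] an algebra that contains the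
    free supercommutative algebra on two copies [x', x''] of the generators and
    send the generator [x] to [(x', x'')].  A word without repeated odd letters
    on either side goes to [(P, P)] where [P] is, up to a nonzero scalar, the
    basis monomial of [T] whose exponents count each [x] among the left letters
    at [x'] and among the right letters at [x''] (lemma [side_meval]).  These
    basis monomials are distinct (lemma [index_exp_inj]).

    Counting is done once for all three gradings.  Give each generator [x] a
    colour [c x] and the weight [U_(c x)]: the three gradings are the colourings
    by the generator itself, by its parity, and by a single colour.  With [S]
    the series of supercommutative monomials, generators contribute
    [\sum_x fpsX (c x)] and pairs of nonempty monomials contribute
    [(S - 1) ^+ 2] (lemma [hilbert_coef]), which gives
    [hilbert_series_coloured]. *)

(** * Supercommutative monomial algebras *)

Section LinearExtension.
Context {K : fieldType} {n : nat} {V : lmodType K}.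
Implicit Types (f : {mpoly K[n]}) (m : 'X_{1..n}).

Definition lin_ext (h : 'X_{1..n} -> V) f : V :=
  \sum_(m <- msupp f) f@_m *: h m.

Lemma lin_extX h m : lin_ext h 'X_[m] = h m.
Proof. by rewrite /lin_ext msuppX big_seq1 mcoeffX eqxx scale1r. Qed.

Lemma lin_extE h f (s : seq 'X_{1..n}) :
  uniq s -> {subset msupp f <= s} -> lin_ext h f = \sum_(m <- s) f@_m *: h m.
Proof.
move=> s_uniq fs; rewrite [RHS](bigID (mem (msupp f))) /=.
rewrite [X in _ + X]big1 ?addr0 => [|m mf]; last first.
  by rewrite memN_msupp_eq0 ?scale0r.
rewrite -big_filter; apply: perm_big; apply: uniq_perm => [||m].
- exact: msupp_uniq.
- exact: filter_uniq.
- by rewrite mem_filter /= andb_idr //; apply: fs.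
Qed.

Lemma lin_ext_linear h : linear (lin_ext h).
Proof.
move=> c f g; pose s := undup (msupp (c *: f + g) ++ msupp f ++ msupp g).
have s_uniq : uniq s by apply: undup_uniq.
rewrite !(@lin_extE h _ s) => // [|m mf|m mf|m mf];
  rewrite ?mem_undup ?mem_cat ?mf ?orbT //.
rewrite scaler_sumr -big_split; apply: eq_bigr => m _ /=.
by rewrite mcoeffD mcoeffZ scalerDl scalerA.
Qed.

HB.instance Definition _ h :=
  GRing.isLinear.Build K {mpoly K[n]} V _ (lin_ext h) (lin_ext_linear h).

(** Asking for agreement on the monomials of [f] alone makes room for hypotheses
    on the parity of [f]. *)
Lemma linear_mpoly_ext (phi psi : {linear {mpoly K[n]} -> V}) f :
  (forall m, m \in msupp f -> phi 'X_[m] = psi 'X_[m]) -> phi f = psi f.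
Proof.
move=> h; rewrite [f]mpolyE !linear_sum big_seq [RHS]big_seq.
by apply: eq_bigr => m mf; rewrite !linearZ /= h.
Qed.

End LinearExtension.

Section SupercommutativeAlgebra.
Context {K : fieldType} {n : nat} (par : 'I_n -> bool).
Implicit Types (a b c m : 'X_{1..n}) (f g h : {mpoly K[n]}).

(** The exponents of the monomials without a repeated odd variable. *)
Definition admissible m := [forall i, par i ==> (m i <= 1)%N].

Definition mparity m := odd (\sum_(i | par i) m i).

(** Sorting the product of two sorted monomials moves each odd variable of the
    second one past the odd variables of larger index in the first one. *)
Definition inversions a b :=
  (\sum_(i | par i) \sum_(j | par j && (j < i)) a i * b j)%N.

(** Setting the structure constant to 0 outside the admissible exponents lets
    the algebra live on the whole space of polynomials: it is the sum of the
    free supercommutative algebra and of the span of the inadmissible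
    monomials, which annihilate everything.  No quotient has to be formed. *)
Definition koszul a b : K :=
  if admissible (a + b)%MM then (-1) ^+ inversions a b else 0.

Definition scmul f g : {mpoly K[n]} :=
  lin_ext (fun a => lin_ext (fun b => koszul a b *: 'X_[a + b]) g) f.

(** Multiplication on the right, named so that it carries a linear structure
    of its own. *)
Definition scmulr g f := scmul f g.

Lemma scmul_is_linear f : linear (scmul f).
Proof.
move=> c g h; rewrite /scmul /lin_ext scaler_sumr -big_split.
apply: eq_bigr => a _ /=.
by rewrite -!/(lin_ext _ _) linearP scalerDr !scalerA mulrC.
Qed.

Lemma scmulr_is_linear g : linear (scmulr g).
Proof. exact: lin_ext_linear. Qed.

HB.instance Definition _ f := GRing.isLinear.Build K {mpoly K[n]} {mpoly K[n]}
  _ (scmul f) (scmul_is_linear f).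
HB.instance Definition _ g := GRing.isLinear.Build K {mpoly K[n]} {mpoly K[n]}
  _ (scmulr g) (scmulr_is_linear g).

Lemma scmulXX a b : scmul 'X_[a] 'X_[b] = koszul a b *: 'X_[a + b].
Proof. by rewrite /scmul !lin_extX. Qed.

Lemma scmulZl x f g : scmul (x *: f) g = x *: scmul f g.
Proof. exact: (linearZ_LR (scmulr g)). Qed.

Lemma scmulZr x f g : scmul f (x *: g) = x *: scmul f g.
Proof. exact: linearZ. Qed.

Lemma admissibleW a b : admissible (a + b)%MM -> admissible a /\ admissible b.
Proof.
move=> /forallP ab; split; apply/forallP => i; move: (ab i);
  by case: (par i) => //=; apply: leq_trans; rewrite mnmDE ?leq_addr ?leq_addl.
Qed.

Lemma koszul_neq0 a b : admissible (a + b)%MM -> koszul a b != 0.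
Proof. by rewrite /koszul => ->; rewrite signr_eq0. Qed.

Lemma inversionsDl a b c :
  inversions (a + b) c = (inversions a c + inversions b c)%N.
Proof.
rewrite -big_split; apply: eq_bigr => i _; rewrite -big_split.
by apply: eq_bigr => j _; rewrite mnmDE mulnDl.
Qed.

Lemma inversionsDr a b c :
  inversions a (b + c) = (inversions a b + inversions a c)%N.
Proof.
rewrite -big_split; apply: eq_bigr => i _; rewrite -big_split.
by apply: eq_bigr => j _; rewrite mnmDE mulnDr.
Qed.

(** Associativity on monomials.  The sign exponent is bilinear, and the factors
    of an admissible product are admissible. *)
Lemma koszul_cocycle a b c :
  koszul a b * koszul (a + b) c = koszul b c * koszul a (b + c).
Proof.
rewrite /koszul addmA; case: ifP => [ab|]; case: ifP => [abc|nabc].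
- have [_ ->] : admissible a /\ admissible (b + c)%MM.
    by apply: admissibleW; rewrite addmA.
  by rewrite -!exprD inversionsDl inversionsDr addnA [in RHS]addnC.
- by rewrite !mulr0.
- by have [ab] := admissibleW abc; rewrite ab.
- by rewrite mul0r mulr0.
Qed.

Lemma scmulA f g h : scmul f (scmul g h) = scmul (scmul f g) h.
Proof.
apply: (@linear_mpoly_ext _ _ _ (scmulr (scmul g h)) (scmulr h \o scmulr g)) => a _.
apply: (@linear_mpoly_ext _ _ _ (scmul 'X_[a] \o scmulr h)
                          (scmulr h \o scmul 'X_[a])) => b _.
apply: (@linear_mpoly_ext _ _ _ (scmul 'X_[a] \o scmul 'X_[b])
                          (scmul (scmul 'X_[a] 'X_[b]))) => c _ /=.
rewrite /scmulr !scmulXX scmulZl scmulZr !scmulXX !scalerA addmA.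
by rewrite koszul_cocycle.
Qed.

(** The inversions of [(a, b)] and of [(b, a)] together count the pairs of odd
    variables with distinct indices.  Pairs with equal indices are missing, but
    they do not occur when [a + b] is admissible, so the total is the product of
    the two odd degrees. *)
Lemma koszul_swap a b :
  koszul a b = (-1) ^+ (mparity a && mparity b) * koszul b a.
Proof.
rewrite /koszul addmC; case: ifP => [ba|]; last by rewrite mulr0.
suff -> : mparity a && mparity b = odd (inversions a b + inversions b a).
  by rewrite signr_odd exprD -mulrA -expr2 sqrr_sign mulr1.
rewrite /mparity -oddM big_distrlr /= /inversions.
rewrite [X in (_ + X)%N](exchange_big_dep par) /=; last by move=> i j _ /andP[].
rewrite -big_split /=; congr odd; apply: eq_bigr => i pi.
rewrite (bigID (fun j : 'I_n => j < i)%N) /=; congr (_ + _)%N.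
rewrite (bigID (fun j : 'I_n => j == i)) /= big1 ?add0n => [|j].
  rewrite [RHS]big_mkcond [LHS]big_mkcond; apply: eq_bigr => j _.
  by rewrite -leqNgt pi /= [(i < j)%N]ltn_neqAle mulnC eq_sym -val_eqE /= andbA andbAC.
move=> /andP[_ /eqP ->].
have /forallP/(_ i) := ba; rewrite pi mnmDE /=.
by case: (a i) (b i) => [|[|?]] [|[|?]]; rewrite ?addnS.
Qed.

Definition of_parity i : {pred {mpoly K[n]}} :=
  [pred f | all (fun m => mparity m == i) (msupp f)].

Lemma of_parityP i f :
  reflect (forall m, m \in msupp f -> mparity m = i) (f \in of_parity i).
Proof. by rewrite inE; apply: (iffP allP) => h m /h /eqP. Qed.

Lemma of_parityX m : 'X_[m] \in of_parity (mparity m).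
Proof. by apply/of_parityP => k /mem_msuppXP <-. Qed.

Lemma of_parity_submod i : submod_closed (of_parity i).
Proof.
split=> [|c f g /of_parityP hf /of_parityP hg].
  by apply/of_parityP => m; rewrite msupp0.
apply/of_parityP => m /msuppD_le; rewrite mem_cat => /orP[|/hg //].
by move/msuppZ_le/hf.
Qed.

HB.instance Definition _ i := GRing.isSubmodClosed.Build K {mpoly K[n]}
  (of_parity i) (of_parity_submod i).

Lemma mparityD a b : mparity (a + b) = mparity a (+) mparity b.
Proof.
by rewrite /mparity -oddD -big_split; congr odd; apply: eq_bigr => i _; apply: mnmDE.
Qed.

Lemma mparity1 i : mparity U_(i) = par i.
Proof.
rewrite /mparity big_mkcond (bigD1 i) //= big1 ?addn0 => [|j /negPf ji].
  by rewrite mnm1E eqxx; case: (par i).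
by rewrite mnm1E eq_sym ji if_same.
Qed.

Lemma of_parity_mul i j f g :
  f \in of_parity i -> g \in of_parity j -> scmul f g \in of_parity (i (+) j).
Proof.
move=> /of_parityP hf /of_parityP hg.
rewrite /scmul /lin_ext big_seq; apply: rpred_sum => a /hf <-; apply: rpredZ.
rewrite big_seq; apply: rpred_sum => b /hg <-; do 2!apply: rpredZ.
by rewrite -mparityD of_parityX.
Qed.

Lemma scmulC i j f g : f \in of_parity i -> g \in of_parity j ->
  scmul f g = (-1) ^+ (i && j) *: scmul g f.
Proof.
move=> /of_parityP hf /of_parityP hg.
apply: (@linear_mpoly_ext _ _ _ (scmulr g) ((-1) ^+ (i && j) \*: scmul g)) => a /hf <-.
apply: (@linear_mpoly_ext _ _ _ (scmul 'X_[a]) (_ \*: scmulr 'X_[a])) => b /hg <- /=.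
by rewrite /scmulr !scmulXX scalerA addmC koszul_swap.
Qed.

End SupercommutativeAlgebra.

(** * The doubled bicommutative superalgebra *)

Section DoubledAlgebra.
Context {K : fieldType} {n : nat} (par : 'I_n -> bool).
Let T : lmodType K := {mpoly K[n]}.
Let TT : lmodType K := (T * T)%type.
Implicit Types u v : TT.

(** The first coordinate of an element is its value as a left factor, the second
    one its value as a right factor; for a product the two coincide. *)
Definition dbl_mul u v : TT := let t := scmul par u.1 v.2 in (t, t).

Definition dbl_part i : {pred TT} :=
  [pred u | (u.1 \in of_parity par i) && (u.2 \in of_parity par i)].

Lemma dbl_partE i u : (u \in dbl_part i) =
  (u.1 \in of_parity par i) && (u.2 \in of_parity par i).
Proof. by []. Qed.

Fact dbl_mul_linearr u : linear (dbl_mul u).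
Proof. by move=> c v w; rewrite /dbl_mul /= linearP. Qed.

Fact dbl_mul_linearl v : linear (dbl_mul^~ v).
Proof.
move=> c u w; have E := scmulr_is_linear par v.2 c u.1 w.1.
by rewrite /scmulr in E; rewrite /dbl_mul [(_ + _).1]/= E.
Qed.

Fact dbl_part_submod i : submod_closed (dbl_part i).
Proof.
have := of_parity_submod (K := K) par i; case=> part0 partP; split=> [|c u v].
  by rewrite dbl_partE; apply/andP.
rewrite !dbl_partE => /andP[u1 u2] /andP[v1 v2].
by apply/andP; split; [apply: (partP c u.1 v.1) | apply: (partP c u.2 v.2)].
Qed.

Fact parity_split (f : T) : exists f0 f1,
  [/\ f0 \in of_parity par false, f1 \in of_parity par true & f = f0 + f1].
Proof.
pose part b := \sum_(m <- msupp f | mparity par m == b) f@_m *: 'X_[m] : T.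
exists (part false), (part true); split.
- by apply: rpred_sum => m /eqP <-; rewrite rpredZ ?of_parityX.
- by apply: rpred_sum => m /eqP <-; rewrite rpredZ ?of_parityX.
rewrite {1}[f]mpolyE (bigID (fun m => mparity par m == false)).
by congr (_ + _); apply: eq_bigl => m; case: mparity.
Qed.

Fact parity_cap (f : T) :
  f \in of_parity par false -> f \in of_parity par true -> f = 0.
Proof.
move=> /of_parityP f0 /of_parityP f1; apply/eqP; rewrite -msupp_eq0.
by case: (msupp f) f0 f1 => // m s f0 f1; have := f0 m (mem_head _ _);
  rewrite f1 ?mem_head.
Qed.

Fact dbl_part_sum u : exists u0 u1,
  [/\ u0 \in dbl_part false, u1 \in dbl_part true & u = u0 + u1].
Proof.
have [a0 [a1 [a0P a1P ea]]] := parity_split u.1.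
have [b0 [b1 [b0P b1P eb]]] := parity_split u.2.
exists (a0, b0), (a1, b1); rewrite !dbl_partE a0P a1P b0P b1P; split=> //.
by rewrite [u]surjective_pairing ea eb.
Qed.

Fact dbl_part_cap u : u \in dbl_part false -> u \in dbl_part true -> u = 0.
Proof.
rewrite !dbl_partE => /andP[a0 b0] /andP[a1 b1].
by rewrite [u]surjective_pairing (parity_cap a0 a1) (parity_cap b0 b1).
Qed.

Fact dbl_part_mul i j u v :
  u \in dbl_part i -> v \in dbl_part j -> dbl_mul u v \in dbl_part (i (+) j).
Proof.
by rewrite !dbl_partE => /andP[u1 _] /andP[_ v2]; rewrite andbb of_parity_mul.
Qed.

Definition doubled : superalgebra K :=
  Superalgebra dbl_mul_linearr dbl_mul_linearl dbl_part_submod dbl_part_sum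
    dbl_part_cap dbl_part_mul.

(** Both sides of either identity are triple products in [T], and they differ by
    the exchange of two adjacent homogeneous factors. *)
Lemma doubled_bicommutative : bicommutative doubled.
Proof.
move=> i j k u v w; rewrite !dbl_partE => /andP[ui _] /andP[vj vj'] /andP[_ wk].
pose diag (t : T) : TT := (t, t).
have diagZ c t : diag (c *: t) = c *: diag t by [].
split; rewrite /smul /= /dbl_mul /= -!/(diag _) -diagZ; congr diag.
  by rewrite !scmulA (scmulC ui vj) scmulZl.
by rewrite -!scmulA (scmulC vj' wk) linearZ.
Qed.

Context {X : Type} (var : bool -> X -> 'I_n).

(** The exponent of coordinate [s] of the image of [w] ([false] for the first);
    [var s x] is the variable that represents [x] in that coordinate. *)
Fixpoint sided_exp (s : bool) (w : monomial X) : 'X_{1..n} :=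
  match w with
  | MGen x => U_(var s x)%MM
  | MMul a b => (sided_exp false a + sided_exp true b)%MM
  end.

Definition doubled_gen (x : X) : doubled :=
  ('X_(var false x) : T, 'X_(var true x) : T).

Definition side (s : bool) (u : doubled) : {mpoly K[n]} := if s then u.2 else u.1.

Fact side_is_linear s : linear (side s).
Proof. by case: s. Qed.
HB.instance Definition _ s := GRing.isLinear.Build K doubled {mpoly K[n]} _
  (side s) (side_is_linear s).

Lemma doubled_gen_parity (parX : X -> bool) :
  (forall s x, par (var s x) = parX x) ->
  forall x, doubled_gen x \in spart doubled (parX x).
Proof.
move=> parE x; apply/andP; split.
  by rewrite -(parE false x) -mparity1 of_parityX.
by rewrite -(parE true x) -mparity1 of_parityX.
Qed.

(** The exponents of the factors of a monomial with admissible exponent are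
    admissible too, so no structure constant met on the way is zero. *)
Lemma side_meval s w : admissible par (sided_exp s w) ->
  exists2 c : K, c != 0 &
    side s (Defs.meval doubled_gen w) = c *: 'X_[sided_exp s w].
Proof.
elim: w s => [x s _|a IHa b IHb s /= ab].
  by exists 1; rewrite ?oner_eq0 // scale1r; case: s.
have [aP bP] := admissibleW ab.
have [c c0 ea] := IHa false aP; have [d d0 eb] := IHb true bP.
exists (c * (d * koszul par (sided_exp false a) (sided_exp true b))).
  by rewrite !mulf_neq0 // koszul_neq0.
have -> : side s (smul (Defs.meval doubled_gen a) (Defs.meval doubled_gen b)) =
    scmul par (side false (Defs.meval doubled_gen a))
              (side true (Defs.meval doubled_gen b)).
  by case: s.
by rewrite ea eb scmulZl scmulZr scmulXX !scalerA mulrA.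
Qed.

End DoubledAlgebra.

(** * Normal form of monomials *)

(** The normal form results from rewriting with the two bicommutative identities,
    so it is proved for an arbitrary congruence that satisfies them without
    signs.  Equality up to sign is such a congruence. *)
Record bicommutative_congruence (X : Type) (E : monomial X -> monomial X -> Prop) :
    Prop := BicommutativeCongruence {
  bc_equiv : Equivalence E;
  bc_mul : forall a a' b b', E a a' -> E b b' -> E (MMul a b) (MMul a' b');
  bc_left : forall a b c, E (MMul a (MMul b c)) (MMul b (MMul a c));
  bc_right : forall a b c, E (MMul (MMul a b) c) (MMul (MMul a c) b) }.

Definition lmuls (X : Type) (l : seq X) (w : monomial X) :=
  foldr (fun x => MMul (MGen x)) w l.
Definition rmuls (X : Type) (r : seq X) (w : monomial X) :=
  foldr (fun y v => MMul v (MGen y)) w r.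
(** The left letters are [x :: l] and the right letters [y :: r]; keeping the
    core [x y] apart makes both lists nonempty. *)
Definition word (X : Type) (x : X) (l : seq X) (y : X) (r : seq X) :=
  lmuls l (rmuls r (MMul (MGen x) (MGen y))).

Section NormalForm.
Context {X : eqType} {E : monomial X -> monomial X -> Prop}.
Hypothesis bcE : bicommutative_congruence E.
Local Infix "**" := MMul (at level 40, left associativity).
Local Notation "a ~ b" := (E a b) (at level 70).
Implicit Types (a b c w v : monomial X) (l r : seq X).

#[local] Instance E_equiv : Equivalence E := bc_equiv bcE.
Let E_refl a : a ~ a. Proof. reflexivity. Qed.
#[local] Hint Resolve E_refl : core.
#[local] Instance E_mul : Proper (E ==> E ==> E) (@MMul X).
Proof. by move=> a a' aa' b b' bb'; exact: (bc_mul bcE). Qed.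
#[local] Instance E_lmuls l : Proper (E ==> E) (lmuls l).
Proof. by move=> a a' aa'; elim: l => //= x l; apply: (bc_mul bcE); reflexivity. Qed.
#[local] Instance E_rmuls r : Proper (E ==> E) (rmuls r).
Proof. by move=> a a' aa'; elim: r => //= y r IH; apply: (bc_mul bcE). Qed.

Let lc a b c : a ** (b ** c) ~ b ** (a ** c). Proof. exact: (bc_left bcE). Qed.
Let rc a b c : a ** b ** c ~ a ** c ** b. Proof. exact: (bc_right bcE). Qed.

Definition product w : bool := if w is MMul _ _ then true else false.

Lemma lmuls_product l w : product w -> product (lmuls l w).
Proof. by case: l. Qed.
Lemma rmuls_product r w : product w -> product (rmuls r w).
Proof. by case: r. Qed.

(** Writing [v = c d], both sides are congruent to [(c b) (a d)]. *)
Lemma mul_assoc_product a v b : product v -> a ** (v ** b) ~ a ** v ** b.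
Proof. by case: v => // c d _; rewrite (rc c d b) (lc a _ d) (lc a c d) (rc c). Qed.

Lemma lmuls_rmuls l r v : product v ->
  lmuls l (rmuls r v) ~ rmuls r (lmuls l v).
Proof.
move=> vP; elim: l => //= x l ->; have {vP}: product (lmuls l v).
  exact: lmuls_product.
elim: r (lmuls l v) => //= y r IH w wP.
by rewrite mul_assoc_product ?rmuls_product // IH.
Qed.

Lemma foldr_perm (f : X -> monomial X -> monomial X) l l' w :
  (forall x a b, a ~ b -> f x a ~ f x b) ->
  (forall x y a, f x (f y a) ~ f y (f x a)) ->
  perm_eq l l' -> foldr f w l ~ foldr f w l'.
Proof.
move=> f_proper fC; elim: l l' => [|x l IH] l'.
  by rewrite perm_sym => /perm_nilP ->.
move=> pl; have x_in : x \in l' by rewrite -(perm_mem pl) mem_head.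
case/splitPr: x_in pl => s t.
rewrite perm_sym perm_catC /= perm_cons perm_catC perm_sym => /IH eq_l.
transitivity (f x (foldr f w (s ++ t))); first exact: f_proper.
elim: s {eq_l} => //= z s IHs.
by rewrite (fC x z); apply: f_proper.
Qed.

Lemma lmuls_perm l l' w : perm_eq l l' -> lmuls l w ~ lmuls l' w.
Proof.
apply: foldr_perm => [x a b|x y a]; last exact: lc.
by apply: (bc_mul bcE).
Qed.

Lemma rmuls_perm r r' w : perm_eq r r' -> rmuls r w ~ rmuls r' w.
Proof.
apply: foldr_perm => [x a b ab|x y a]; last exact: rc.
exact: (bc_mul bcE).
Qed.

(** Up to congruence the left multiplications of a word may be made innermost;
    multiplication by the letter [x] of the core [x y] is then one of them, and
    all left letters are on the same footing. *)
Lemma word_lmuls x l y r : word x l y r ~ rmuls r (lmuls (rcons l x) (MGen y)).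
Proof. by rewrite /word lmuls_rmuls // /lmuls foldr_rcons. Qed.

Lemma word_rmuls x l y r : word x l y r = lmuls l (rmuls (rcons r y) (MGen x)).
Proof. by rewrite /word /rmuls foldr_rcons. Qed.

Lemma word_perm x l y r x' l' y' r' :
  perm_eq (x :: l) (x' :: l') -> perm_eq (y :: r) (y' :: r') ->
  word x l y r ~ word x' l' y' r'.
Proof.
move=> pl pr; transitivity (word x' l' y r).
  rewrite !word_lmuls (@lmuls_perm (rcons l x) (rcons l' x')) //.
  by rewrite !perm_rcons (permPl pl) perm_sym perm_rcons.
rewrite !word_rmuls (@rmuls_perm (rcons r y) (rcons r' y')) //.
by rewrite !perm_rcons (permPl pr) perm_sym perm_rcons.
Qed.

Lemma lmuls_rmuls_cat k l r s v : product v ->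
  lmuls k (rmuls s (lmuls l (rmuls r v))) ~ lmuls (k ++ l) (rmuls (s ++ r) v).
Proof.
move=> vP; rewrite -lmuls_rmuls ?rmuls_product //.
by rewrite /lmuls /rmuls !foldr_cat.
Qed.

(** Multiplication by a monomial acts on products through its letters.  For a
    product [v], [(a b) v] is congruent to [(a v) b] and [v (a b)] to [a (v b)];
    thus the left action of [a b] involves the left action of [a] and the right
    action of [b], as does its right action, and the two statements have to be
    proved together. *)
Lemma mul_by_letters w :
  (exists l r, forall v, product v -> w ** v ~ lmuls l (rmuls r v)) /\
  (exists l r, forall v, product v -> v ** w ~ lmuls l (rmuls r v)).
Proof.
elim: w => [x|a [[la [ra La]] _] b [_ [lb [rb Rb]]]].
  by split; [exists [:: x], [::] | exists [::], [:: x]].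
split.
  exists (lb ++ la), (rb ++ ra) => v vP.
  by rewrite -lmuls_rmuls_cat // -La // -Rb // rc.
exists (la ++ lb), (ra ++ rb) => v vP.
by rewrite -lmuls_rmuls_cat // -Rb // -La // lc.
Qed.

Lemma product_word w : product w -> exists x l y r, w ~ word x l y r.
Proof.
have ext l r v : (exists x k y s, v ~ word x k y s) ->
    exists x k y s, lmuls l (rmuls r v) ~ word x k y s.
  move=> [x [k [y [s e]]]]; exists x, (l ++ k), y, (r ++ s).
  by rewrite e /word lmuls_rmuls_cat.
elim: w => // a IHa b IHb _; case: (boolP (product b)) => [bP|].
  have [[l [r eqv]] _] := mul_by_letters a.
  by have [x [k [y [s e]]]] := ext l r b (IHb bP); exists x, k, y, s; rewrite eqv.
case: b IHb => // y _ _; case: (boolP (product a)) => [aP|].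
  have [x [k [z [s e]]]] := ext [::] [:: y] a (IHa aP).
  by exists x, k, z, s.
by case: a IHa => // x _ _; exists x, [::], y, [::].
Qed.

End NormalForm.

Section Weights.
Context {X : Type}.
Implicit Types (w : monomial X) (l r : seq X).

Lemma sided_exp_word n (var : bool -> X -> 'I_n) s x l y r :
  sided_exp var s (word x l y r) =
  (\sum_(z <- x :: l) U_(var false z) + \sum_(z <- y :: r) U_(var true z))%MM.
Proof.
rewrite /word; elim: l s => [|z l IH] s /=; last first.
  by rewrite IH !big_cons addmA; congr (_ + _)%MM; apply: Monoid.mulmCA.
elim: r s => [|z r IH] s /=; first by rewrite !big_seq1.
rewrite IH !big_cons -addmA; congr (_ + _)%MM.
by rewrite addmC Monoid.mulmCA.
Qed.

Lemma mweight_word n (wt : X -> 'X_{1..n}) x l y r :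
  Defs.mweight wt (word x l y r) =
  (\sum_(z <- x :: l) wt z + \sum_(z <- y :: r) wt z)%MM.
Proof.
rewrite /word; elim: l => [|z l IH] /=; last first.
  by rewrite IH !big_cons addmA; congr (_ + _)%MM; apply: Monoid.mulmCA.
elim: r => [|z r IH] /=; first by rewrite !big_seq1.
rewrite IH !big_cons -addmA; congr (_ + _)%MM.
by rewrite addmC Monoid.mulmCA.
Qed.
End Weights.

Section Evaluation.
Context {K : fieldType} {X : eqType} {A : superalgebra K} (g : X -> A).
Context {n : nat} (wt : X -> 'X_{1..n}) (par : X -> bool).
Hypothesis bcA : bicommutative A.
Hypothesis gpar : forall x, g x \in spart A (par x).
Implicit Types (w : monomial X) (l r : seq X).
Local Notation eval := (Defs.meval g).

Lemma eval_homogeneous w : exists i, eval w \in spart A i.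
Proof.
elim: w => [x|a [i ai] b [j bj]]; first by exists (par x); apply: gpar.
by exists (i (+) j); apply: spart_mul.
Qed.

Lemma smulZl c (u v : A) : smul (c *: u) v = c *: smul u v.
Proof.
have lin := smul_linearl v; have /= := lin c u 0.
have -> : smul 0 v = 0 by have /= := lin (-1) 0 0; rewrite scaler0 addr0 scaleN1r addNr.
by rewrite !addr0.
Qed.

Lemma smulZr c (u v : A) : smul u (c *: v) = c *: smul u v.
Proof.
have lin := smul_linearr u; have /= := lin c v 0.
have -> : smul u 0 = 0 by have /= := lin (-1) 0 0; rewrite scaler0 addr0 scaleN1r addNr.
by rewrite !addr0.
Qed.

(** Weights are part of the relation so that rewriting a monomial in normal form
    keeps it in its homogeneous component. *)
Definition same_up_to_sign w w' : Prop :=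
  Defs.mweight wt w = Defs.mweight wt w' /\
  exists s : bool, eval w = (-1) ^+ s *: eval w'.

Lemma same_up_to_sign_congruence : bicommutative_congruence same_up_to_sign.
Proof.
split.
- split=> [w|w w' [ew [s es]]|u v w [eu [s es]] [ev [t et]]].
  + by split=> //; exists false; rewrite scale1r.
  + by split=> //; exists s; rewrite es scalerA -expr2 sqrr_sign scale1r.
  + split; first by rewrite eu.
    by exists (s (+) t); rewrite es et scalerA signr_addb.
- move=> a a' b b' [ea [s es]] [eb [t et]]; split=> /=; first by rewrite ea eb.
  by exists (s (+) t); rewrite es et smulZl smulZr scalerA signr_addb.
- move=> a b c; split=> /=; first by rewrite Monoid.mulmCA.
  have [i ai] := eval_homogeneous a; have [j bj] := eval_homogeneous b.
  have [k ck] := eval_homogeneous c.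
  by exists (i && j); have [->] := bcA ai bj ck.
move=> a b c; split=> /=; first by rewrite Monoid.mulmAC.
have [i ai] := eval_homogeneous a; have [j bj] := eval_homogeneous b.
have [k ck] := eval_homogeneous c.
by exists (j && k); have [_ ->] := bcA ai bj ck.
Qed.

Hypothesis charK : 2%N \notin [pchar K].

Lemma double_eq0 (v : A) : v = - v -> v = 0.
Proof.
move=> vN; have : (2%:R : K) *: v = 0.
  by rewrite scaler_nat mulr2n {1}vN addNr.
move/eqP; rewrite scaler_eq0 => /orP[/eqP two0|/eqP //].
by case/negP: charK; rewrite inE /= two0 eqxx.
Qed.

Lemma perm_repeated x l : (1 < count_mem x l)%N ->
  exists k, perm_eq l [:: x, x & k].
Proof.
move=> xl; have x_in : x \in l by rewrite -has_pred1 has_count ltnW.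
have pl := perm_to_rem x_in; exists (rem x (rem x l)).
rewrite (permPl pl) perm_cons perm_to_rem //.
by move: xl; rewrite (permP pl) /= eqxx ltnS -has_count has_pred1.
Qed.

(** Two equal odd letters can be brought together, and exchanging them changes
    the sign. *)
Lemma lmuls_repeated l x w :
  par x -> (1 < count_mem x l)%N -> eval (lmuls l w) = 0.
Proof.
move=> px /perm_repeated[k pk].
have [_ [s ->]] := lmuls_perm same_up_to_sign_congruence w pk.
have [i vi] := eval_homogeneous (lmuls k w).
have [] := bcA (gpar x) (gpar x) vi; rewrite px /= expr1 scaleN1r => e _.
by rewrite (double_eq0 e) scaler0.
Qed.

Lemma rmuls_repeated r y w :
  par y -> (1 < count_mem y r)%N -> eval (rmuls r w) = 0.
Proof.
move=> py /perm_repeated[k pk].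
have [_ [s ->]] := rmuls_perm same_up_to_sign_congruence w pk.
have [i vi] := eval_homogeneous (rmuls k w).
have [_] := bcA vi (gpar y) (gpar y); rewrite py /= expr1 scaleN1r => e.
by rewrite (double_eq0 e) scaler0.
Qed.

Lemma smul0l (v : A) : smul 0 v = 0.
Proof. by have := smulZl 0 0 v; rewrite !scale0r. Qed.
Lemma smul0r (v : A) : smul v 0 = 0.
Proof. by have := smulZr 0 v 0; rewrite !scale0r. Qed.

Lemma word_repeated z x l y r : par z ->
  (1 < count_mem z (x :: l))%N || (1 < count_mem z (y :: r))%N ->
  eval (word x l y r) = 0.
Proof.
move=> pz /orP[zl|zr].
  have [_ [s ->]] := word_lmuls same_up_to_sign_congruence x l y r.
  suff -> : eval (rmuls r (lmuls (rcons l x) (MGen y))) = 0 by rewrite scaler0.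
  elim: r => /= [|u r ->]; last by rewrite smul0l.
  by apply: lmuls_repeated pz _; rewrite (permP (permEl (perm_rcons x l))).
rewrite word_rmuls; elim: l => /= [|u l ->]; last by rewrite smul0r.
by apply: rmuls_repeated pz _; rewrite (permP (permEl (perm_rcons y r))).
Qed.

End Evaluation.

(** * Power series below a given degree *)

Section Truncation.
Context {k : nat}.
Implicit Types (f g : fps k) (m a b : 'X_{1..k}).

Definition eq_below d f g :=
  forall m, (mdeg m < d)%N -> fcoef f m = fcoef g m.

Lemma eq_below_add d f f' g g' :
  eq_below d f f' -> eq_below d g g' -> eq_below d (f + g) (f' + g').
Proof. by move=> ff gg m md; rewrite /= ff ?gg. Qed.

Lemma eq_below_mul d f f' g g' :
  eq_below d f f' -> eq_below d g g' -> eq_below d (f * g) (f' * g').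
Proof.
move=> ff gg m md; apply: eq_bigr => -[[m1 d1] [m2 d2]] /= /eqP em.
by rewrite ff ?gg // (leq_ltn_trans _ md) // em mdegD ?leq_addr ?leq_addl.
Qed.

Lemma eq_below_prod d (I : Type) (r : seq I) (F G : I -> fps k) :
  (forall i, eq_below d (F i) (G i)) ->
  eq_below d (\prod_(i <- r) F i) (\prod_(i <- r) G i).
Proof. by move=> FG; elim/big_rec2: _ => // i f g _; apply: eq_below_mul. Qed.

Definition mon a : fps k := FPS (fun m => (m == a)%:R).

Lemma mon0 : mon 0 = 1. Proof. by []. Qed.

Lemma mulXmon i a : fpsX i * mon a = mon (U_(i) + a).
Proof.
apply: fpsP => m; rewrite fps_coefXM /=; case: posnP => [mi0|mi].
  case: eqP => // em; have := congr1 (fun l : 'X_{1..k} => l i) em.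
  by rewrite mi0 mnmDE mnm1E eqxx.
congr (nat_of_bool _)%:R; apply/eqP/eqP => [<-|->].
  rewrite addmC submK //; apply/mnm_lepP => j.
  by rewrite mnm1E; case: eqP => [<-|].
by rewrite addmC addmK.
Qed.

Lemma mulXnmon i e a : fpsX i ^+ e * mon a = mon (U_(i) *+ e + a).
Proof.
elim: e => [|e IH]; first by rewrite mul1r mulm0n add0m.
by rewrite exprS -mulrA IH mulXmon mulmS addmA.
Qed.

Lemma fpsXn_mon i e : fpsX i ^+ e = mon (U_(i) *+ e).
Proof. by rewrite -[LHS]mulr1 -mon0 mulXnmon addm0. Qed.

Lemma monM a b : mon a * mon b = mon (a + b).
Proof.
have mulp (r : seq 'I_k) m :
    (\prod_(i <- r) fpsX i ^+ a i) * mon m = mon (\sum_(i <- r) U_(i) *+ a i + m).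
  elim: r => [|i r IH]; first by rewrite !big_nil mul1r add0m.
  by rewrite !big_cons -mulrA IH mulXnmon addmA.
have -> : mon a = \prod_i fpsX i ^+ a i.
  by rewrite -[RHS]mulr1 -mon0 mulp addm0 -multinomUE_id.
by rewrite mulp -multinomUE_id.
Qed.

Lemma mon_prod (I : Type) (r : seq I) (w : I -> 'X_{1..k}) :
  \prod_(i <- r) mon (w i) = mon (\sum_(i <- r) w i).
Proof. by elim/big_rec2: _ => // i a f _ ->; rewrite monM. Qed.

Lemma fcoef_sum_mon (J : finType) (P : pred J) (w : J -> 'X_{1..k}) m :
  fcoef (\sum_(j | P j) mon (w j)) m = #|[pred j | P j & w j == m]|%:Z.
Proof.
rewrite (big_morph (fun f => fcoef f m) (id1 := 0) (op1 := +%R)) //.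
rewrite -natz -sum1_card natr_sum big_mkcond [RHS]big_mkcond.
by apply: eq_bigr => j _; rewrite inE /= eq_sym; case: (P j) => //; case: eqP.
Qed.

Lemma eq_below_mulmon f a d : (d <= mdeg a)%N -> eq_below d (mon a * f) 0.
Proof.
move=> da m md; apply: big1 => -[[m1 d1] [m2 d2]] /= /eqP em.
case: eqP => [e1|]; last by rewrite mul0r.
by move: (leq_trans md da); rewrite em e1 mdegD ltnNge leq_addr.
Qed.

(** [1 - fpsX i] times the truncated sum is [1 - fpsX i ^+ d]. *)
Lemma geometric_below d i :
  eq_below d (1 / (1 - fpsX i)) (\sum_(e < d) fpsX i ^+ e).
Proof.
have geom : (1 - fpsX i) * (\sum_(e < d) fpsX i ^+ e) = 1 - fpsX i ^+ d.
  by rewrite -[RHS]opprB subrX1 -mulNr opprB.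
have -> : 1 / (1 - fpsX i) =
    \sum_(e < d) fpsX i ^+ e + mon (U_(i) *+ d) * (1 - fpsX i)^-1.
  apply: (mulrI (fps_geom_unit i)); rewrite mulrDr geom div1r mulrCA.
  by rewrite !mulrV ?fps_geom_unit // mulr1 -fpsXn_mon subrK.
rewrite -[X in eq_below _ _ X]addr0; apply: eq_below_add => //.
by apply: eq_below_mulmon; rewrite mdegMn mdeg1 mul1n.
Qed.

End Truncation.

(** * Counting supercommutative monomials *)

Section Enumeration.
Context {X : finType} {k : nat} (c : X -> 'I_k) (par : X -> bool) (d : nat).

(** Below degree [d.+2] only exponents less than [d.+2] matter.  The bound is at
    least 2 so that every squarefree monomial is represented. *)
Local Notation exponent := {ffun X -> 'I_d.+2}.

Definition exp_ok (a : exponent) := [forall x, par x ==> (a x <= 1)%N].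

Definition exp_weight (a : exponent) : 'X_{1..k} := (\sum_x U_(c x) *+ a x)%MM.

Definition supercommutative_series : fps k :=
  \prod_x (if par x then 1 + fpsX (c x) else 1 / (1 - fpsX (c x))).

Definition exp0 : exponent := [ffun=> ord0].

Lemma exp_weight0 : exp_weight exp0 = 0%MM.
Proof. by rewrite /exp_weight big1 // => x _; rewrite ffunE mulm0n. Qed.

Lemma supercommutative_series_below :
  eq_below d.+2 supercommutative_series (\sum_(a | exp_ok a) mon (exp_weight a)).
Proof.
pose Q x (e : 'I_d.+2) := par x ==> (e <= 1)%N.
have -> : \sum_(a | exp_ok a) mon (exp_weight a) =
    \prod_x \sum_(e | Q x e) fpsX (c x) ^+ e :> fps k.
  rewrite bigA_distr_big_dep; apply: eq_big => a.
    by apply/forallP/familyP => h x; apply: h.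
  by move=> _; rewrite -mon_prod; apply: eq_bigr => x _; rewrite fpsXn_mon.
apply: eq_below_prod => x; rewrite /Q; case: (par x) => /=; last exact: geometric_below.
by rewrite big_mkcond !big_ord_recl /= big1 ?addr0 // => e _.
Qed.

(** The generators, and the pairs formed by the exponents of the left and of the
    right letters. *)
Definition basis_index : finType := (X + exponent * exponent)%type.

Definition index_ok (j : basis_index) : bool :=
  match j with
  | inl _ => true
  | inr (a, b) => [&& exp_ok a, a != exp0, exp_ok b & b != exp0]
  end.

Definition index_weight (j : basis_index) : 'X_{1..k} :=
  match j with
  | inl x => U_(c x)
  | inr (a, b) => (exp_weight a + exp_weight b)%MM
  end.

Lemma hilbert_coef m : (mdeg m < d.+2)%N ->
  fcoef (\sum_x fpsX (c x) + (supercommutative_series - 1) ^+ 2) m =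
  #|[pred j | index_ok j & index_weight j == m]|%:Z.
Proof.
move=> md; rewrite -fcoef_sum_mon; suff: eq_below d.+2
    (\sum_x fpsX (c x) + (supercommutative_series - 1) ^+ 2)
    (\sum_(j | index_ok j) mon (index_weight j)) by apply.
rewrite big_sumType /=; apply: eq_below_add => //.
have below1 : eq_below d.+2 (supercommutative_series - 1)
    (\sum_(a | exp_ok a && (a != exp0)) mon (exp_weight a)).
  have -> : \sum_(a | exp_ok a && (a != exp0)) mon (exp_weight a) =
      \sum_(a | exp_ok a) mon (exp_weight a) - 1 :> fps k.
    rewrite [X in X - 1](bigD1 exp0) /=; last first.
      by apply/forallP => x; rewrite ffunE implybT.
    by rewrite exp_weight0 mon0 addrAC subrr add0r.
  by apply: eq_below_add => //; apply: supercommutative_series_below.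
have -> : \sum_(i | index_ok (inr i)) mon (index_weight (inr i)) =
    (\sum_(a | exp_ok a && (a != exp0)) mon (exp_weight a)) ^+ 2 :> fps k.
  rewrite expr2 big_distrlr /= pair_big /=; apply: eq_big => [[a b]|[a b] _] /=.
    by rewrite !andbA.
  by rewrite monM.
exact: eq_below_mul.
Qed.

End Enumeration.

Arguments basis_index : clear implicits.

(** * The basis of a homogeneous component *)

Lemma mnm_sum_count (X : finType) n (h : X -> 'X_{1..n}) (l : seq X) :
  (\sum_(z <- l) h z = \sum_x h x *+ count_mem x l)%MM.
Proof.
apply/mnmP => i; rewrite !mnm_sumE.
under [RHS]eq_bigr => x _ do rewrite mulmnE.
elim: l => [|z l IH]; first by rewrite big_nil big1 // => x _; rewrite muln0.
rewrite big_cons IH /=; under [RHS]eq_bigr => x _ do rewrite mulnDr.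
rewrite big_split /=; congr (_ + _)%N; rewrite (bigD1 z) //= eqxx muln1.
by rewrite big1 ?addn0 // => x /negPf zx; rewrite eq_sym zx muln0.
Qed.

Lemma independent_monomials (K : fieldType) n (V : lmodType K) (d : nat)
    (b : 'I_d -> V) (phi : {linear V -> {mpoly K[n]}}) (e : 'I_d -> 'X_{1..n}) :
  injective e ->
  (forall i, exists2 c : K, c != 0 & phi (b i) = c *: 'X_[e i]) ->
  forall c : 'I_d -> K, \sum_i c i *: b i = 0 -> forall i, c i = 0.
Proof.
move=> e_inj phib c c0 i0; have [x x0 ex] := phib i0.
have := congr1 (fun v => (phi v)@_(e i0)) c0.
rewrite linear_sum linear0 mcoeff0 raddf_sum (bigD1 i0) //= linearZ /= ex.
rewrite mcoeffZ mcoeffZ mcoeffX eqxx mulr1 big1 ?addr0 => [/eqP|i i_i0].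
  by rewrite mulf_eq0 (negPf x0) orbF => /eqP.
have [y _ ey] := phib i.
by rewrite linearZ /= ey !mcoeffZ mcoeffX (inj_eq e_inj) (negPf i_i0) !mulr0.
Qed.

Section WordsOfExponents.
Context {X : finType} {d : nat}.
Local Notation exponent := {ffun X -> 'I_d.+2}.
Implicit Types (a b : exponent).

Definition exp_list a : seq X := flatten [seq nseq (a x) x | x <- enum X].

Lemma count_exp_list a x : count_mem x (exp_list a) = a x.
Proof.
rewrite /exp_list count_flatten -map_comp sumnE big_map big_enum /=.
rewrite (bigD1 x) //= count_nseq /= eqxx mul1n big1 ?addn0 // => y /negPf yx.
by rewrite count_nseq /= yx mul0n.
Qed.

Lemma perm_exp_list a l : (forall x, count_mem x l = a x) -> perm_eq l (exp_list a).
Proof. by move=> h; apply/allP => x _ /=; rewrite h count_exp_list. Qed.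

Lemma exp_list_neq0 a : a != exp0 d -> exists x l, exp_list a = x :: l.
Proof.
case E: (exp_list a) => [|x l]; last by exists x, l.
case/eqP; apply/ffunP => x; rewrite ffunE; apply: val_inj => /=.
by rewrite -count_exp_list E.
Qed.

Context {K : fieldType} {A : superalgebra K} (g : X -> A).

(** At the indices selected by [index_ok] both lists are nonempty, and the
    default value 0 does not occur. *)
Definition basis_vector (j : basis_index X d) : A :=
  match j with
  | inl x => g x
  | inr (a, b) =>
      if exp_list a is x :: l then
        if exp_list b is y :: r then Defs.meval g (word x l y r) else 0
      else 0
  end.

Definition variable (s : bool) (x : X) : 'I_#|{: X + X}| :=
  enum_rank (if s then inr x else inl x : X + X).

Definition index_exp (j : basis_index X d) : 'X_{1.. #|{: X + X}|} :=
  match j with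
  | inl x => U_(variable false x)
  | inr (a, b) => (\sum_x U_(variable false x) *+ a x +
                   \sum_x U_(variable true x) *+ b x)%MM
  end.

Lemma variable_eq s t x y : (variable s x == variable t y) = (s == t) && (x == y).
Proof. by rewrite /variable (inj_eq enum_rank_inj); case: s t => [] []. Qed.

Lemma index_exp_coord a b s x :
  index_exp (inr (a, b)) (variable s x) = (if s then b x else a x) :> nat.
Proof.
have coord t (f : exponent) : (\sum_y U_(variable t y) *+ f y)%MM (variable s x) =
    (if s == t then f x : nat else 0)%N.
  rewrite mnm_sumE (bigD1 x) //= big1 ?addn0 => [|y /negPf yx].
    by rewrite mulmnE mnm1E variable_eq eqxx andbT eq_sym; case: eqP;
      rewrite ?mul1n ?mul0n.
  by rewrite mulmnE mnm1E variable_eq yx andbF.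
by rewrite /= mnmDE !coord; case: s {coord} => /=; rewrite ?addn0.
Qed.

Context (par : X -> bool).

(** The exponents of a pair are the coordinates of its image.  A pair has a
    nonzero exponent at some right variable, unlike a generator. *)
Lemma index_exp_inj (i j : basis_index X d) :
  index_ok par i -> index_ok par j -> index_exp i = index_exp j -> i = j.
Proof.
have neq x a b : b != exp0 d -> index_exp (inr (a, b)) <> index_exp (inl x).
  move=> b0 e; case/eqP: b0; apply/ffunP => y; rewrite ffunE; apply: val_inj => /=.
  by rewrite -(index_exp_coord a b true y) e /= mnm1E variable_eq.
case: i j => [x|[a b]] [y|[a' b']] //=.
- move=> _ _ /(congr1 (fun m : 'X_{1.. _} => m (variable false x))) /eqP.
  by rewrite !mnm1E !variable_eq !eqxx /=; case: (y =P x) => [->|].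
- by move=> _ /and4P[_ _ _ b0] /esym/neq; case.
- by move=> /and4P[_ _ _ b0] _ /neq; case.
move=> _ _ e; have ab s x := congr1 (fun m : 'X_{1.. _} => m (variable s x)) e.
congr (inr (_, _)); apply/ffunP => x; apply: val_inj.
  by have := ab false x; rewrite !index_exp_coord.
by have := ab true x; rewrite !index_exp_coord.
Qed.

Definition variable_parity (i : 'I_#|{: X + X}|) : bool :=
  match enum_val i with inl x | inr x => par x end.

Lemma variable_parityE s x : variable_parity (variable s x) = par x.
Proof. by rewrite /variable_parity enum_rankK; case: s. Qed.

Lemma index_exp_admissible j :
  index_ok par j -> admissible variable_parity (index_exp j).
Proof.
move=> jP; apply/forallP => i.
have [s [x ->]] : exists s x, i = variable s x.
  rewrite -(enum_valK i); case: (enum_val i) => x; first by exists false, x.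
  by exists true, x.
rewrite variable_parityE; apply/implyP => px.
case: j jP => [y|[a b]] /=; first by rewrite mnm1E; case: (_ == _).
move=> /and4P[/forallP/(_ x) ax _ /forallP/(_ x) bx _].
by rewrite index_exp_coord; move: ax bx; rewrite px; case: s.
Qed.

Lemma basis_vector_word k (c : X -> 'I_k) (j : basis_index X d) :
  index_ok par j -> exists w, [/\ basis_vector j = Defs.meval g w,
    Defs.mweight (fun x => U_(c x)%MM) w = index_weight c j &
    sided_exp variable false w = index_exp j].
Proof.
case: j => [x _|[a b] /and4P[_ a0 _ b0]]; first by exists (MGen x).
have [x [l ea]] := exp_list_neq0 a0; have [y [r eb]] := exp_list_neq0 b0.
exists (word x l y r); rewrite /basis_vector ea eb; split=> //.
  rewrite mweight_word -ea -eb (mnm_sum_count _ (exp_list a))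
    (mnm_sum_count _ (exp_list b)); congr (_ + _)%MM;
  by apply: eq_bigr => z _; rewrite count_exp_list.
rewrite sided_exp_word -ea -eb (mnm_sum_count _ (exp_list a))
    (mnm_sum_count _ (exp_list b)); congr (_ + _)%MM;
by apply: eq_bigr => z _; rewrite count_exp_list.
Qed.

Hypothesis charK : 2%N \notin [pchar K].
Hypothesis bcA : bicommutative A.
Hypothesis gpar : forall x, g x \in spart A (par x).

(** The spanning half: the number of letters of [w] is its degree, so the
    multiplicities of its letters are below the bound on exponents. *)
Lemma monomial_basis_vector k (c : X -> 'I_k) w :
  (mdeg (Defs.mweight (fun x => U_(c x)%MM) w) < d.+2)%N ->
  Defs.meval g w = 0 \/
  exists (s : K) (j : basis_index X d), [/\ index_ok par j,
    index_weight c j = Defs.mweight (fun x => U_(c x)%MM) w &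
    Defs.meval g w = s *: basis_vector j].
Proof.
set wt := fun x => U_(c x)%MM => w_d.
case: (boolP (product w)) => [wP|]; last first.
  by case: w {w_d} => // x _; right; exists 1, (inl x); rewrite scale1r.
have bc := same_up_to_sign_congruence wt bcA gpar.
have [x [l [y [r [ew [s es]]]]]] := product_word bc wP.
have size_l (t : seq X) : mdeg (\sum_(z <- t) wt z)%MM = size t.
  by rewrite mdeg_sum; under eq_bigr do rewrite mdeg1; rewrite sum1_size.
have deg_lr : (size (x :: l) + size (y :: r) < d.+2)%N.
  by rewrite -!size_l -mdegD -mweight_word -ew.
pose ex (t : seq X) : exponent := [ffun z => inord (count_mem z t)].
have exE t z : (size t < d.+2)%N -> ex t z = count_mem z t :> nat.
  by move=> td; rewrite ffunE inordK // (leq_ltn_trans (count_size _ _) td).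
have l_d : (size (x :: l) < d.+2)%N := leq_ltn_trans (leq_addr _ _) deg_lr.
have r_d : (size (y :: r) < d.+2)%N := leq_ltn_trans (leq_addl _ _) deg_lr.
case: (boolP (exp_ok par (ex (x :: l)) && exp_ok par (ex (y :: r)))) =>
    [/andP[lP rP]|]; last first.
  rewrite /exp_ok negb_and !negb_forall => rep; left.
  suff [z pz zP] : exists2 z, par z &
      (1 < count_mem z (x :: l))%N || (1 < count_mem z (y :: r))%N.
    by rewrite es (word_repeated wt bcA gpar charK pz zP) scaler0.
  by case/orP: rep => /existsP[z]; rewrite negb_imply exE // -ltnNge => /andP[pz zP];
    exists z; rewrite ?zP ?orbT.
right; set a := ex (x :: l) in lP *; set b := ex (y :: r) in rP *.
have pa : perm_eq (x :: l) (exp_list a) by apply: perm_exp_list => z; rewrite exE.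
have pb : perm_eq (y :: r) (exp_list b) by apply: perm_exp_list => z; rewrite exE.
have neq0 z t : (size (z :: t) < d.+2)%N -> ex (z :: t) != exp0 d.
  move=> td; apply/eqP => /(congr1 (fun f : exponent => val (f z))).
  by rewrite /= exE // ffunE /= eqxx.
have jP : index_ok par (inr (a, b)) by rewrite /= lP rP !neq0.
have [x' [l' ea]] := exp_list_neq0 (neq0 _ _ l_d).
have [y' [r' eb]] := exp_list_neq0 (neq0 _ _ r_d).
move: pa pb; rewrite ea eb => pa pb.
have [_ [t et]] := word_perm bc pa pb.
exists ((-1) ^+ (s (+) t)), (inr (a, b)); split=> //.
  rewrite ew mweight_word (mnm_sum_count _ (x :: l))
    (mnm_sum_count _ (y :: r)); congr (_ + _)%MM;
  by apply: eq_bigr => z _; rewrite exE.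
by rewrite es et scalerA signr_addb /basis_vector ea eb.
Qed.

End WordsOfExponents.

(** * Hilbert series *)

Section HilbertSeries.
Context {K : fieldType} {p q : nat} {F : superalgebra K} (g : 'I_p + 'I_q -> F).
Hypothesis charK : 2%N \notin [pchar K].
Hypothesis freeF : free_bicommutative g.
Context {k : nat} (c : 'I_p + 'I_q -> 'I_k).
Let X : finType := ('I_p + 'I_q)%type.
Let par : X -> bool := @gen_parity p q.

Lemma hilbert_series_coloured :
  is_hilbert_series g (fun x => U_(c x)%MM)
    (\sum_x fpsX (c x) + (supercommutative_series c par - 1) ^+ 2).
Proof.
move=> m; have [bcF gpar univ] := freeF.
pose J := [pred j : basis_index X (mdeg m) | index_ok par j & index_weight c j == m].
exists #|J|; last by rewrite (@hilbert_coef _ _ c par (mdeg m)).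
pose b (i : 'I_#|J|) := basis_vector g (enum_val i).
have bP (i : 'I_#|J|) : index_ok par (enum_val i) /\
    index_weight c (enum_val i) = m.
  by have /andP[-> /eqP] : J (enum_val i) := enum_valP i.
exists b; split.
  (* The map to the doubled algebra separates the basis vectors. *)
  have [phi [[phiM _] phig _]] := univ _ _
    (@doubled_bicommutative K _ (variable_parity par))
    (doubled_gen_parity (variable_parityE par)).
  apply: (@independent_monomials _ _ _ _ b (side false \o phi)
            (fun i => index_exp (enum_val i))) => [i j eij|i].
    have [[iok _] [jok _]] := (bP i, bP j).
    by apply: enum_val_inj; apply: index_exp_inj iok jok eij.
  have [ok _] := bP i; have [w [bw _ we]] := basis_vector_word g c ok.
  have phi_eval u : phi (Defs.meval g u) =
      Defs.meval (doubled_gen (variable_parity par) variable) u.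
    by elim: u => [x|u IHu u' IHu'] /=; rewrite ?phiM ?IHu ?IHu'.
  have adm := index_exp_admissible ok; rewrite -we in adm *.
  by have [x x0 ex] := side_meval (K := K) adm; exists x; rewrite //= /b bw phi_eval.
move=> v; split=> [[r [x [s [sP ->]]]]|[x ->]]; last first.
  exists #|J|, x, b; split=> // i; have [ok ei] := bP i.
  have [w [bw ww _]] := basis_vector_word g c ok.
  by exists w => //; rewrite ww.
have comb i : exists y : 'I_#|J| -> K, s i = \sum_l y l *: b l.
  have [w wm ->] := sP i.
  case: (@monomial_basis_vector _ (mdeg m) _ _ g par charK bcF gpar _ c w).
  - by rewrite wm.
  - by move=> ->; exists (fun=> 0); rewrite big1 // => l _; rewrite scale0r.
  move=> [t [j [jok jw ->]]].
  have jJ : j \in J by rewrite inE jok jw wm eqxx.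
  exists (fun l => if l == enum_rank_in jJ j then t else 0).
  rewrite (bigD1 (enum_rank_in jJ j)) //= eqxx /b enum_rankK_in // big1 ?addr0 //.
  by move=> l /negPf ->; rewrite scale0r.
have [y yP] := fin_all_exists comb.
exists (fun l => \sum_i x i * y i l).
under [RHS]eq_bigr => l _ do rewrite scaler_suml.
rewrite exchange_big; apply: eq_bigr => i _ /=.
by rewrite yP scaler_sumr; apply: eq_bigr => l _; rewrite scalerA.
Qed.

End HilbertSeries.

Theorem theorem3p2 (K : fieldType) (p q : nat) (F : superalgebra K)
    (g : 'I_p + 'I_q -> F)
    (charK : 2%N \notin [pchar K])
    (freeF : free_bicommutative g) :
  let U (i : 'I_p) : fps (p + q) := fpsX (lshift q i) in
  let V (j : 'I_q) : fps (p + q) := fpsX (rshift p j) in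
  let u : fps 2 := fpsX ord0 in
  let v : fps 2 := fpsX ord_max in
  let t : fps 1 := fpsX ord0 in
  [/\ is_hilbert_series g (@multidegree p q)
        (\sum_(i < p) U i + \sum_(j < q) V j
         + (\prod_(i < p) (1 / (1 - U i)) * \prod_(j < q) (1 + V j) - 1) ^+ 2),
      is_hilbert_series g (@bidegree p q)
        (p%:R * u + q%:R * v + ((1 + v) ^+ q / (1 - u) ^+ p - 1) ^+ 2)
    & is_hilbert_series g (@total_degree p q)
        ((p + q)%:R * t + ((1 + t) ^+ q / (1 - t) ^+ p - 1) ^+ 2)].
Proof.
move=> U V u v t.
have constE k (x y : fps k) :
    \prod_(i < p) (1 / (1 - x)) * \prod_(j < q) (1 + y) = (1 + y) ^+ q / (1 - x) ^+ p.
  by rewrite !prodr_const !card_ord div1r exprVn mulrC.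
split.
- pose c (x : 'I_p + 'I_q) : 'I_(p + q) :=
    match x with inl i => lshift q i | inr j => rshift p j end.
  have -> : @multidegree p q = fun x => U_(c x)%MM by apply/funext => -[].
  have := hilbert_series_coloured charK freeF c.
  by rewrite /supercommutative_series !big_sumType.
- pose c (x : 'I_p + 'I_q) : 'I_2 := if x is inl _ then ord0 else ord_max.
  have -> : @bidegree p q = fun x => U_(c x)%MM by apply/funext => -[].
  have := hilbert_series_coloured charK freeF c.
  rewrite /supercommutative_series !big_sumType /= constE.
  by rewrite !sumr_const !card_ord !mulr_natl.
have := hilbert_series_coloured charK freeF (fun=> ord0 : 'I_1).
rewrite /supercommutative_series !big_sumType /= constE.
by rewrite !sumr_const !card_ord -mulrnDr mulr_natl.
Qed.
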